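(* Let $R$ be a commutative ring with identity. Then $QPrim(R)$ is an irreducible space if and only if the nilradical $\mathcal{N}(R)$ of $R$ is a quasi-primary ideal.
   Context: An ideal $I$ of $R$ is quasi-primary if its radical $\sqrt{I}$ is a prime ideal; $QPrim(R)$ denotes the set of all quasi-primary ideals of $R$. It carries the Zariski topology, whose closed sets are the sets $V_q(I)=\{Q\in QPrim(R): I\subseteq \sqrt{Q}\}$ for ideals $I$ of $R$. A topological space $X$ is irreducible if $X$ is nonempty and $X$ cannot be written as a union of two proper closed subsets; equivalently, $X$ is nonempty and any two nonempty open subsets of $X$ intersect. *)

(* Defs.v *)
From HB Require Import structures.
From mathcomp Require Import all_boot all_order all_algebra.
From mathcomp Require Import all_classical topology.

Set Implicit Arguments.
Unset Strict Implicit.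
Unset Printing Implicit Defensive.

Import GRing.Theory.

Local Open Scope ring_scope.
Local Open Scope classical_set_scope.

(* MathComp's [idealr] and [prime_idealr] are boolean predicates over a
   nontrivial ring, and an [idealr] is always proper; hence the notions below,
   on arbitrary subsets of a possibly trivial commutative ring. *)
Section Ideals.
Context {R : comPzRingType}.
Implicit Types (I J P Q S : set R).

Definition ideal I : Prop :=
  [/\ I 0,
      forall x y, I x -> I y -> I (x + y)
    & forall a x, I x -> I (a * x)].

Definition prime_ideal P : Prop :=
  [/\ ideal P,
      P <> setT
    & forall x y, P (x * y) -> P x \/ P y].

Definition radical I : set R :=
  [set x | exists2 n : nat, (0 < n)%N & I (x ^+ n)].

Definition quasi_primary Q : Prop := ideal Q /\ prime_ideal (radical Q).

End Ideals.

Definition nilradical (R : comPzRingType) : set R :=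
  [set x | exists2 n : nat, (0 < n)%N & x ^+ n = 0].
Arguments nilradical R : clear implicits.

Record QPrim (R : comPzRingType) := {
  qprim_set :> set R;
  qprimP : quasi_primary qprim_set
}.

HB.instance Definition _ (R : comPzRingType) := gen_eqMixin (QPrim R).
HB.instance Definition _ (R : comPzRingType) := gen_choiceMixin (QPrim R).

Definition Vq (R : comPzRingType) (I : set R) : set (QPrim R) :=
  [set Q : QPrim R | I `<=` radical Q].

Section ZariskiTopology.
Context {R : comPzRingType}.
Implicit Types (I J S : set R).

Definition zariski_open : set_system (QPrim R) :=
  [set U | exists2 I, ideal I & ~` U = Vq I].

Lemma ideal0 : ideal [set 0 : R].
Proof.
split=> //= [x y -> ->|a x ->]; [exact: addr0|exact: mulr0].
Qed.

Lemma idealT : ideal [set: R].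
Proof. by []. Qed.

Lemma idealI I J : ideal I -> ideal J -> ideal (I `&` J).
Proof.
move=> [I0 ID IM] [J0 JD JM]; split=> //= [x y [? ?] [? ?]|a x [? ?]].
  by split; [exact: ID|exact: JD].
by split; [exact: IM|exact: JM].
Qed.

Lemma radical_prime (Q : QPrim R) : prime_ideal (radical Q).
Proof. by case: (qprimP Q). Qed.

Let zariski_openT : zariski_open setT.
Proof.
exists setT; first exact: idealT.
apply/seteqP; split=> [Q /=|Q QT _] //.
have [_ + _] := radical_prime Q; apply.
by apply/seteqP; split.
Qed.

Let zariski_openI : setI_closed zariski_open.
Proof.
move=> U V [I idI UI] [J idJ VJ]; exists (I `&` J); first exact: idealI.
rewrite setCI UI VJ; apply/seteqP; split=> [Q [IQ|JQ] x [Ix Jx]|Q IJQ].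
- exact: IQ.
- exact: JQ.
- apply: contrapT => /not_orP[/existsNP[x /not_implyP[Ix nQx]]].
  move=> /existsNP[y /not_implyP[Jy nQy]].
  have [_ _ /(_ x y)] := radical_prime Q.
  have Qxy : radical Q (x * y).
    apply: IJQ; split; last by case: idJ => _ _; exact.
    by rewrite mulrC; case: idI => _ _; exact.
  by case=> //.
Qed.

Let zariski_open_bigU (T : Type) (f : T -> set (QPrim R)) :
  (forall i, zariski_open (f i)) -> zariski_open (\bigcup_i f i).
Proof.
move=> fop.
pose S := [set x | exists i J, [/\ ideal J, ~` f i = Vq J & J x]].
exists [set x | forall J, ideal J -> S `<=` J -> J x].
  split=> /= [J [] //|x y Sx Sy J idJ SJ|a x Sx J idJ SJ].
    by have [_ + _] := idJ; apply; [exact: Sx|exact: Sy].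
  by have [_ _] := idJ; apply; exact: Sx.
apply/seteqP; split=> [Q nfQ x|Q genQ [i _ fQ]].
  apply; first by case: (radical_prime Q).
  move=> y [i [J [idJ fJ Jy]]].
  have : (~` f i) Q by move=> fQ; apply: nfQ; exists i.
  by rewrite fJ; exact.
have [J idJ fJ] := fop i.
have : Vq J Q.
  by move=> x Jx; apply: genQ => K idK; apply; exists i, J.
by rewrite -fJ; exact.
Qed.

HB.instance Definition _ := isOpenTopological.Build (QPrim R)
  zariski_openT zariski_openI zariski_open_bigU.

End ZariskiTopology.

Lemma closed_QPrimE (R : comPzRingType) (F : set (QPrim R)) :
  closed F <-> exists2 I : set R, ideal I & F = Vq I.
Proof. by rewrite -openC; split=> -[I idI FI]; exists I; rewrite // -FI setCK. Qed.

Definition irreducible_space (X : topologicalType) : Prop :=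
  [set: X] !=set0 /\
  ~ exists A B : set X,
      [/\ closed A, closed B, A <> setT, B <> setT & A `|` B = setT].

(* Main.v *)
Require Import Defs.
From HB Require Import structures.
From mathcomp Require Import all_boot all_order all_algebra.
From mathcomp Require Import all_classical topology.

(** The closed sets of [QPrim R] only see radicals, so a quasi-primary ideal
    whose radical lies below every other radical is a generic point.  The
    nilradical N lies in every radical ([nilradical_sub_radical]) and is its own
    radical; if it is quasi-primary it is therefore a generic point, and a
    space with a generic point is irreducible.

    Conversely, suppose that [QPrim R] is irreducible.  If x * y is nilpotent,
    then every prime [radical Q] contains x * y, hence x or y: the closed sets
    of the points Q with x, respectively y, in [radical Q] cover the space, and
    by irreducibility one of them, say that of x, is everything.  Every prime
    ideal is its own radical, so it is a point of the space and contains x.  By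
    Krull's theorem ([nilradicalP]: the nilradical is the intersection of the
    prime ideals), x is nilpotent.  Thus N is prime; it is proper because
    [QPrim R] has a point.  Krull's theorem itself comes from Zorn's lemma: an
    ideal maximal among those disjoint from a multiplicative set is prime
    ([exists_prime_disjoint]). *)

Set Implicit Arguments.
Unset Strict Implicit.
Unset Printing Implicit Defensive.

Import GRing.Theory.

Local Open Scope ring_scope.
Local Open Scope classical_set_scope.

Section PrimeIdeals.
Context {R : comPzRingType}.
Implicit Types (I P Q S : set R) (x y : R).

Definition add_principal I x : set R :=
  [set z | exists2 p, I p & exists r, z = p + r * x].

Lemma ideal_add_principal I x : ideal I -> ideal (add_principal I x).
Proof.
move=> [I0 ID IM]; split=> [|y z [p Ip [r ->]] [q Iq [s ->]]|a y [p Ip [r ->]]].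
- by exists 0 => //; exists 0; rewrite mul0r addr0.
- by exists (p + q); [exact: ID|exists (r + s); rewrite mulrDl addrACA].
- by exists (a * p); [exact: IM|exists (a * r); rewrite mulrDr mulrA].
Qed.

Lemma sub_add_principal I x : I `<=` add_principal I x.
Proof. by move=> p Ip; exists p => //; exists 0; rewrite mul0r addr0. Qed.

Lemma mem_add_principal I x : ideal I -> add_principal I x x.
Proof. by case=> I0 _ _; exists 0 => //; exists 1; rewrite mul1r add0r. Qed.

(** Two ideals I + (x) and I + (y) strictly above a maximal I both meet S, and
    the product of the two common elements lies in I + (x * y); so x * y cannot
    lie in I. *)
Lemma exists_prime_disjoint S :
    S 1 -> (forall x y, S x -> S y -> S (x * y)) -> ~ S 0 ->
  exists P, prime_ideal P /\ (forall x, S x -> ~ P x).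
Proof.
move=> S1 SM nS0.
(* The union of the empty chain is empty, so Zorn's lemma is applied to a family
   that also admits the empty set; a maximal member is not empty, since the
   zero ideal is in the family. *)
pose F I := [/\ (forall x y, I x -> I y -> I (x + y)),
  (forall a x, I x -> I (a * x)) & (forall x, S x -> ~ I x)].
have [|I [[ID IM IS] Imax]] := @Zorn_bigcup R F.
  move=> C CF Ctot; split=> [x y [I CI Ix] [J CJ Jy]|a x [I CI Ix]|x Sx [I CI]].
  - have [IJ|JI] := Ctot _ _ CI CJ.
      by exists J => //; have [JD _ _] := CF _ CJ; apply: JD => //; exact: IJ.
    by exists I => //; have [ID _ _] := CF _ CI; apply: ID => //; exact: JI.
  - by exists I => //; have [_ IM _] := CF _ CI; exact: IM.
  - by have [_ _ IS] := CF _ CI; exact: IS.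
have I0 : I 0.
  apply: contrapT => nI0.
  have Ieq0 x : ~ I x by move=> /(IM 0); rewrite mul0r.
  apply: (Imax [set 0]).
    by split=> [x /Ieq0//|/(_ 0 erefl)].
  have [_ ZD ZM] := @ideal0 R.
  by split=> // x + x0; rewrite x0.
have idI : ideal I by split.
have meets x : ~ I x -> exists2 s, S s & add_principal I x s.
  move=> nIx; apply: contrapT => noS.
  apply: (Imax (add_principal I x)).
    by split; [exact: sub_add_principal|move/(_ x (mem_add_principal x idI))].
  have [_ JD JM] := ideal_add_principal x idI.
  by split=> // s Ss Js; apply: noS; exists s.
exists I; split=> //; split=> // [IT|x y Ixy].
  by apply: (IS 1) => //; rewrite IT.
apply: contrapT => /not_orP[nIx nIy].
have [s Ss [p Ip [r def_s]]] := meets _ nIx.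
have [t St [q Iq [r' def_t]]] := meets _ nIy.
apply: (IS _ (SM _ _ Ss St)).
rewrite def_s mulrDl; apply: (ID); first by rewrite mulrC; exact: IM.
by rewrite def_t mulrDr mulrACA; apply: ID; exact: IM.
Qed.

Lemma prime_ideal_exp P x n : prime_ideal P -> P (x ^+ n) -> P x.
Proof.
move=> [[_ _ PM] _ Pp]; elim: n => [|n IHn].
  by rewrite expr0 => /(PM x); rewrite mulr1.
by rewrite exprS => /Pp[].
Qed.

Lemma radical_prime_ideal P : prime_ideal P -> radical P = P.
Proof.
move=> primeP; apply/seteqP; split=> x; last by exists 1%N.
by case=> n _; exact: prime_ideal_exp.
Qed.

Lemma quasi_primary_prime P : prime_ideal P -> quasi_primary P.
Proof. by move=> pP; split; [case: pP|rewrite radical_prime_ideal]. Qed.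

Lemma nilradical_sub_radical Q : ideal Q -> nilradical R `<=` radical Q.
Proof. by case=> Q0 _ _ x [n n_gt0 xn0]; exists n; rewrite ?xn0. Qed.

(** Applied to the powers of x, which avoid 0 when x is not nilpotent, the
    existence of a prime ideal disjoint from a multiplicative set gives Krull's
    description of the nilradical. *)
Lemma nilradicalP x : nilradical R x <-> forall P, prime_ideal P -> P x.
Proof.
split=> [Nx P primeP|allP].
  rewrite -(radical_prime_ideal primeP).
  by apply: nilradical_sub_radical => //; case: primeP.
apply: contrapT => nNx.
have [||[n xn0]|P [primeP]] := @exists_prime_disjoint [set x ^+ n | n in setT].
- by exists 0%N; rewrite ?expr0.
- by move=> _ _ [m _ <-] [n _ <-]; exists (m + n)%N; rewrite ?exprD.
- (* The exponent may be 0, which happens in the trivial ring. *)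
  by move=> xn; apply: nNx; exists n.+1; rewrite // exprS xn mulr0.
- by move/(_ x); apply; [exists 1%N|exact: allP].
Qed.

Lemma radical_nilradical : radical (nilradical R) = nilradical R.
Proof.
apply/seteqP; split=> x; last by exists 1%N.
by move=> [n n0 [m m0 xnm]]; exists (n * m)%N; rewrite ?muln_gt0 ?n0 ?exprM.
Qed.

Lemma ideal_nilradical : ideal (nilradical R).
Proof.
split=> [|x y /nilradicalP Nx /nilradicalP Ny|a x /nilradicalP Nx].
- by exists 1%N.
- apply/nilradicalP => P pP; have [[_ PD _] _ _] := pP.
  by apply: PD; [exact: Nx|exact: Ny].
- by apply/nilradicalP => P pP; have [[_ _ PM] _ _] := pP; apply: PM; exact: Nx.
Qed.

Lemma closed_radical_mem x : closed [set Q : QPrim R | radical Q x].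
Proof.
apply/closed_QPrimE; exists (add_principal [set 0] x).
  exact: ideal_add_principal (@ideal0 R).
apply/seteqP; split=> Q /= Qx; last exact/Qx/mem_add_principal/ideal0.
move=> _ [_ -> [r ->]]; rewrite add0r.
by have [[_ _ QM] _ _] := radical_prime Q; exact: QM.
Qed.

(** Every prime ideal is a point of the space and its own radical, so Krull's
    description of the nilradical applies. *)
Lemma nilradical_radical_mem x :
  [set Q : QPrim R | radical Q x] = setT -> nilradical R x.
Proof.
move=> QxT; apply/nilradicalP => P primeP.
have : [set Q : QPrim R | radical Q x] (Build_QPrim (quasi_primary_prime primeP)).
  by rewrite QxT.
by rewrite /= radical_prime_ideal.
Qed.

End PrimeIdeals.

Section Irreducibility.
Context {R : comPzRingType}.

Lemma irreducible_prime_nilradical :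
  irreducible_space (QPrim R) -> prime_ideal (nilradical R).
Proof.
move=> [[Q _] irr]; split; first exact: ideal_nilradical.
  move=> NT; have [_ + _] := radical_prime Q; apply.
  apply/seteqP; split=> // x _.
  have [idQ _] := qprimP Q.
  by apply: (nilradical_sub_radical idQ); rewrite NT.
move=> x y Nxy; apply: contrapT => /not_orP[nNx nNy]; apply: irr.
exists [set Q : QPrim R | radical Q x], [set Q : QPrim R | radical Q y].
split; [exact: closed_radical_mem|exact: closed_radical_mem| | |].
- by move/nilradical_radical_mem.
- by move/nilradical_radical_mem.
- apply/seteqP; split=> // Q' _; have [_ _ Qp] := radical_prime Q'.
  by apply: Qp; have [idQ _] := qprimP Q'; exact: nilradical_sub_radical Nxy.
Qed.

(** The nilradical, as a point of [QPrim R], is generic: a cover of the space by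
    two closed sets has a member containing it, which is then the whole space. *)
Lemma quasi_primary_nilradical_irreducible :
  quasi_primary (nilradical R) -> irreducible_space (QPrim R).
Proof.
move=> qN; pose N := Build_QPrim qN.
have generic (F : set (QPrim R)) : closed F -> F N -> F = setT.
  move=> /closed_QPrimE[I _ ->] IN; apply/seteqP; split=> // Q _ x /IN /=.
  rewrite radical_nilradical; apply: nilradical_sub_radical.
  by case: (qprimP Q).
split; first by exists N.
move=> [A [B [clA clB AT BT ABT]]].
have : (A `|` B) N by rewrite ABT.
by case=> [/(generic _ clA)|/(generic _ clB)].
Qed.

End Irreducibility.

Theorem theorem2p10 (R : comPzRingType) :
  irreducible_space (QPrim R) <-> quasi_primary (nilradical R).
Proof.
split; last exact: quasi_primary_nilradical_irreducible.
by move=> /irreducible_prime_nilradical; exact: quasi_primary_prime.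
Qed.
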